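(* Let $R$ be a skew-invertible Hecke symmetry (an $N^2\times N^2$ complex matrix), let $M=\|m_i^j\|$ and $D=\|\partial_i^j\|$ be the generating matrices of the algebras $\mathcal{M}(R)$ and $\mathcal{D}(R^{-1})$ in the quantum double, i.e. of the unital associative algebra generated by the $m_i^j,\partial_i^j$ subject to $$R\,M_1R\,M_1=M_1R\,M_1R,\qquad R^{-1}D_1R^{-1}D_1=D_1R^{-1}D_1R^{-1},\qquad D_1R\,M_1=R\,M_1R^{-1}D_1R^{-1}+I,$$ and let $L=MD$. Then for every integer $k\ge 1$ the following two matrix identities hold: $$A^{(k)}L_{\overline 1}\,(L_{\overline 2}+q I)\cdots (L_{\overline k}+q^{k-1}(k-1)_q I)\,A^{(k)}=q^{k(k-1)}A^{(k)}M_{\overline 1}\cdots M_{\overline k}\,D_{\overline k}\cdots D_{\overline 1},$$ $$S^{(k)}L_{\overline 1}\Big(L_{\overline 2}-\frac1q I\Big)\cdots\Big(L_{\overline k}-\frac{(k-1)_q}{q^{k-1}}I\Big)S^{(k)}=q^{-k(k-1)}S^{(k)}M_{\overline 1}\cdots M_{\overline k}\,D_{\overline k}\cdots D_{\overline 1}.$$ The $j$-th factors on the left-hand sides ($1\le j\le k$) are $L_{\overline j}+q^{j-1}(j-1)_qI$ and $L_{\overline j}-q^{-(j-1)}(j-1)_qI$ respectively.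
   Context: Ground field $\mathbb{C}$; $N\ge1$. $R$ is a numerical $N^2\times N^2$ matrix acting on $V\otimes V$, $V=\mathbb{C}^N$. It is a braiding if it is a solution of $R_{12}R_{23}R_{12}=R_{23}R_{12}R_{23}$, where $R_{12}=R\otimes I$, $R_{23}=I\otimes R$. It is a Hecke symmetry if it is a braiding and $(qI\otimes I-R)(q^{-1}I\otimes I+R)=0$ with $q\in\mathbb{C}$, $q\notin\{0,\pm1\}$ (so $R$ is invertible). It is skew-invertible if there is an $N^2\times N^2$ matrix $\Psi$ with $\mathrm{Tr}_{(2)}R_{12}\Psi_{23}=\mathrm{Tr}_{(2)}\Psi_{12}R_{23}=P_{13}$, where $P$ is the flip and $\mathrm{Tr}_{(2)}$ is the usual trace over the second tensor factor. Evenness of $R$ is not assumed. $q$-integers: $k_q=\dfrac{q^k-q^{-k}}{q-q^{-1}}$; it is assumed that $k_q\neq0$ for all $k\ge1$. For a matrix $X=\|x_i^j\|_{1\le i,j\le N}$ ($i$ is the row index, $j$ the column index) with entries in a possibly noncommutative algebra, $X_1=X\otimes I$; products of matrices are usual matrix products with the order of the entries preserved, so $L=MD$ has entries $l_i^j=\sum_k m_i^k\partial_k^j$. In the relation between $D$ and $M$ the symbol $I$ is the identity on $V\otimes V$. $\mathcal{M}(R)$ is the unital associative algebra generated by the $m_i^j$ with the first of the displayed relations; $\mathcal{D}(R^{-1})$ is the one generated by the $\partial_i^j$ with the second; the third relation is the permutation relation of the quantum double. On $V^{\otimes k}$ put $R_i=I^{\otimes(i-1)}\otimes R\otimes I^{\otimes(k-i-1)}$.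 For $X=M,D,L$ (the first copy acting in the first tensor factor) the copies are $X_{\overline 1}=X_1$, $X_{\overline{i+1}}=R_iX_{\overline i}R_i^{-1}$. In the identities of the claim $I$ is the identity on $V^{\otimes k}$. The $R$-skew-symmetrizers $A^{(k)}$ and $R$-symmetrizers $S^{(k)}$ acting on $V^{\otimes k}$ are defined by $A^{(1)}=S^{(1)}=I$ and, for $k\ge2$, $$A^{(k)}_{1\dots k}=\frac1{k_q}A^{(k-1)}_{1\dots k-1}\big(q^{k-1}I^{\otimes k}-(k-1)_qR_{k-1}\big)A^{(k-1)}_{1\dots k-1},$$ $$S^{(k)}_{1\dots k}=\frac1{k_q}S^{(k-1)}_{1\dots k-1}\big(q^{-(k-1)}I^{\otimes k}+(k-1)_qR_{k-1}\big)S^{(k-1)}_{1\dots k-1},$$ where the subscript $1\dots k-1$ means acting in the first $k-1$ tensor factors. *)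

(* Defs.v *)
From HB Require Import structures.
From mathcomp Require Import all_boot all_order all_algebra.
From mathcomp Require Import generic_quotient ring_quotient boolp reals.
From mathcomp Require Import complex mxtens.
From mathcomp Require finmap.
From mathcomp Require Import monalg.

Set Implicit Arguments.
Unset Strict Implicit.
Unset Printing Implicit Defensive.

Import GRing.Theory.
Local Open Scope ring_scope.
Local Open Scope quotient_scope.

(* The free unital associative algebra F<X>: the monoid algebra of the free
   monoid on X. *)
Section FreeAlgebra.
Variables (F : comNzRingType) (X : choiceType).

Definition freealg : Type := {malg F[fmonom X]}.

HB.instance Definition _ := GRing.Lalgebra.on freealg.

Definition freegen (x : X) : freealg := mkmalgU (fmu x) 1.

Lemma freealg_scalerAr (c : F) (x y : freealg) : c *: (x * y) = x * (c *: y).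
Proof.
apply/malgP=> k; rewrite mcoeffZ mcoeffMl.
rewrite (mcoeffMlw k (finmap.fsubset_refl _) (msuppZ_le c y)) mulr_sumr.
apply: eq_bigr=> k1 _; rewrite mulr_sumr; apply: eq_bigr=> k2 _.
by rewrite mcoeffZ mulrnAr mulrCA.
Qed.

HB.instance Definition _ :=
  GRing.Lalgebra_isAlgebra.Build F freealg freealg_scalerAr.

End FreeAlgebra.

(* The quotient of an algebra by the two-sided ideal generated by a set S of
   elements; for A = F<X> it is the algebra presented by the generators X and
   the relations s = 0, s in S.  The structures lalgType and algType require 1 != 0,
   which fails when the ideal is everything; hence quotalg is a pzRingType and
   a lmodType with the lemmas quot_scaleAl and quot_scaleAr. *)
Section QuotientAlgebra.
Variables (F : comNzRingType) (A : algType F) (S : A -> Prop).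

Inductive ideal_gen : A -> Prop :=
| ideal_gen_in x of S x : ideal_gen x
| ideal_gen0 : ideal_gen 0
| ideal_genB x y of ideal_gen x & ideal_gen y : ideal_gen (x - y)
| ideal_genMl a x of ideal_gen x : ideal_gen (a * x)
| ideal_genMr a x of ideal_gen x : ideal_gen (x * a).

Definition ideal_pred : {pred A} := fun x => `[< ideal_gen x >].

Lemma ideal_pred_zmod : zmod_closed ideal_pred.
Proof.
split=> [|x y /asboolP Ix /asboolP Iy]; apply/asboolP; first exact: ideal_gen0.
exact: ideal_genB.
Qed.

HB.instance Definition _ :=
  GRing.isZmodClosed.Build A ideal_pred ideal_pred_zmod.

Definition quotalg : Type := Quotient.quot ideal_pred.
HB.instance Definition _ := GRing.Zmodule.on quotalg.

Definition quot_pi (x : A) : quotalg := \pi_(Quotient.quot ideal_pred) x.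
Definition quot_repr (u : quotalg) : A := repr (u : Quotient.quot ideal_pred).

Lemma quot_reprK : cancel quot_repr quot_pi.
Proof. by move=> u; rewrite /quot_pi /quot_repr reprK. Qed.

Lemma quot_piP x y : quot_pi x = quot_pi y <-> ideal_gen (x - y).
Proof.
split=> [/eqmodP|Ixy]; first by rewrite /= => /asboolP.
by apply/eqmodP; apply/asboolP.
Qed.

Lemma quot_pi_zmod_morphism : zmod_morphism quot_pi.
Proof. by move=> x y; rewrite /quot_pi raddfB. Qed.

HB.instance Definition _ :=
  GRing.isZmodMorphism.Build A quotalg quot_pi quot_pi_zmod_morphism.

Lemma ideal_gen_repr x : ideal_gen (quot_repr (quot_pi x) - x).
Proof. by apply/quot_piP; rewrite quot_reprK. Qed.

Definition quot_one : quotalg := quot_pi 1.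
Definition quot_mul (u v : quotalg) : quotalg :=
  quot_pi (quot_repr u * quot_repr v).
Definition quot_scale (c : F) (u : quotalg) : quotalg :=
  quot_pi (c *: quot_repr u).

Lemma quot_piM x y : quot_mul (quot_pi x) (quot_pi y) = quot_pi (x * y).
Proof.
apply/quot_piP; set a := quot_repr _; set b := quot_repr _.
have -> : a * b - x * y = a * (b - y) - (x - a) * y.
  by rewrite mulrBr mulrBl opprB addrA subrK.
apply: ideal_genB; first by apply: ideal_genMl; exact: ideal_gen_repr.
apply: ideal_genMr; rewrite -opprB -sub0r.
by apply: ideal_genB (ideal_gen_repr x); exact: ideal_gen0.
Qed.

Lemma quot_piZ c x : quot_scale c (quot_pi x) = quot_pi (c *: x).
Proof.
apply/quot_piP; rewrite -scalerBr -[_ - x]mul1r scalerAl.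
by apply: ideal_genMl; exact: ideal_gen_repr.
Qed.

Lemma quot_ind (P : quotalg -> Prop) : (forall x, P (quot_pi x)) -> forall u, P u.
Proof. by move=> Ppi u; rewrite -[u]quot_reprK. Qed.

Lemma quot_mulA : associative quot_mul.
Proof.
elim/quot_ind=> x; elim/quot_ind=> y; elim/quot_ind=> z.
by rewrite !quot_piM mulrA.
Qed.
Lemma quot_mul1 : left_id quot_one quot_mul.
Proof. by elim/quot_ind=> x; rewrite quot_piM mul1r. Qed.
Lemma quot_1mul : right_id quot_one quot_mul.
Proof. by elim/quot_ind=> x; rewrite quot_piM mulr1. Qed.
Lemma quot_mulDl : left_distributive quot_mul +%R.
Proof.
elim/quot_ind=> x; elim/quot_ind=> y; elim/quot_ind=> z.
by rewrite -raddfD !quot_piM mulrDl raddfD.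
Qed.
Lemma quot_mulDr : right_distributive quot_mul +%R.
Proof.
elim/quot_ind=> x; elim/quot_ind=> y; elim/quot_ind=> z.
by rewrite -raddfD !quot_piM mulrDr raddfD.
Qed.

HB.instance Definition _ := GRing.Zmodule_isPzRing.Build quotalg
  quot_mulA quot_mul1 quot_1mul quot_mulDl quot_mulDr.

Lemma quot_scaleA a b u : quot_scale a (quot_scale b u) = quot_scale (a * b) u.
Proof. by elim/quot_ind: u => x; rewrite !quot_piZ scalerA. Qed.
Lemma quot_scale1 : left_id 1 quot_scale.
Proof. by elim/quot_ind=> x; rewrite quot_piZ scale1r. Qed.
Lemma quot_scaleDr : right_distributive quot_scale +%R.
Proof.
move=> c; elim/quot_ind=> x; elim/quot_ind=> y.
by rewrite -raddfD !quot_piZ scalerDr raddfD.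
Qed.
Lemma quot_scaleDl u : {morph quot_scale^~ u : a b / a + b}.
Proof.
by move=> a b; elim/quot_ind: u => x; rewrite !quot_piZ scalerDl raddfD.
Qed.

HB.instance Definition _ := GRing.Zmodule_isLmodule.Build F quotalg
  quot_scaleA quot_scale1 quot_scaleDr quot_scaleDl.

Lemma quot_scaleAl (c : F) (u v : quotalg) : c *: (u * v) = (c *: u) * v.
Proof.
elim/quot_ind: u => x; elim/quot_ind: v => y; rewrite /*:%R/= /*%R/=.
by rewrite quot_piM !quot_piZ quot_piM scalerAl.
Qed.

Lemma quot_scaleAr (c : F) (u v : quotalg) : c *: (u * v) = u * (c *: v).
Proof.
elim/quot_ind: u => x; elim/quot_ind: v => y; rewrite /*:%R/= /*%R/=.
by rewrite quot_piM !quot_piZ quot_piM scalerAr.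
Qed.

Lemma quot_pi_monoid_morphism : monoid_morphism quot_pi.
Proof. by split=> // x y; rewrite [RHS]quot_piM. Qed.

HB.instance Definition _ :=
  GRing.isMonoidMorphism.Build A quotalg quot_pi quot_pi_monoid_morphism.

Lemma quot_pi_scalable : scalable quot_pi.
Proof. by move=> c x; rewrite [RHS]quot_piZ. Qed.

HB.instance Definition _ :=
  GRing.isScalable.Build F A quotalg *:%R quot_pi quot_pi_scalable.

Definition quot_const (c : F) : quotalg := c *: (1 : quotalg).

Lemma quot_const_zmod_morphism : zmod_morphism quot_const.
Proof. by move=> a b; rewrite /quot_const scalerBl. Qed.

HB.instance Definition _ :=
  GRing.isZmodMorphism.Build F quotalg quot_const quot_const_zmod_morphism.

Lemma quot_const_monoid_morphism : monoid_morphism quot_const.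
Proof.
split=> [|a b]; first exact: scale1r.
by rewrite /quot_const -scalerA -quot_scaleAl mul1r.
Qed.

HB.instance Definition _ :=
  GRing.isMonoidMorphism.Build F quotalg quot_const quot_const_monoid_morphism.

End QuotientAlgebra.

(* X in End(V^(x)m) acting on V^(x)n in the tensor factors i, ..., i + m - 1
   (numbered from 1, meaningful when 1 <= i and i + m - 1 <= n).  Then the
   sizes agree and conform_mx is a cast along N^(i-1) N^m N^(n-i-m+1) = N^n. *)
Definition act_on (K : pzRingType) (N m n i : nat) (X : 'M[K]_(N ^ m)) :
    'M[K]_(N ^ n) :=
  conform_mx 0
    ((1%:M : 'M_(N ^ i.-1)) *t X *t (1%:M : 'M_(N ^ (n - (i.-1 + m))))).

Section Braiding.
Variables (F : fieldType) (N : nat).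

Definition Rop (R : 'M[F]_(N ^ 2)) (n i : nat) : 'M[F]_(N ^ n) :=
  act_on n i R.

Definition braiding (R : 'M[F]_(N ^ 2)) : Prop :=
  let R12 := Rop R 3 1 in let R23 := Rop R 3 2 in
  R12 *m R23 *m R12 = R23 *m R12 *m R23.

Definition hecke_symmetry (q : F) (R : 'M[F]_(N ^ 2)) : Prop :=
  braiding R /\ (q%:M - R) *m (q^-1%:M + R) = 0.

(* Basis vectors e_a (x) e_b and e_a (x) e_b (x) e_c, N ^ 2 and N ^ 3 being
   convertible to N * N and N * (N * N). *)
Definition idx2 (a b : 'I_N) : 'I_(N ^ 2) := mxtens_index (a, b).
Definition idx3 (a b c : 'I_N) : 'I_(N ^ 3) := mxtens_index (a, idx2 b c).
Definition unidx2 (i : 'I_(N ^ 2)) : 'I_N * 'I_N := @mxtens_unindex N N i.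

Definition flip : 'M[F]_(N ^ 2) :=
  \matrix_(i, j)
    (((unidx2 i).1 == (unidx2 j).2) && ((unidx2 i).2 == (unidx2 j).1))%:R.

Definition tr2 (X : 'M[F]_(N ^ 3)) : 'M[F]_(N ^ 2) :=
  \matrix_(i, j) \sum_(e < N)
    X (idx3 (unidx2 i).1 e (unidx2 i).2) (idx3 (unidx2 j).1 e (unidx2 j).2).

(* The factors 1 and 3 that survive Tr_(2) are renumbered 1 and 2, so that
   P_13 is the flip of V (x) V. *)
Definition skew_invertible (R : 'M[F]_(N ^ 2)) : Prop :=
  exists Psi : 'M[F]_(N ^ 2),
    tr2 (act_on 3 1 R *m act_on 3 2 Psi) = flip /\
    tr2 (act_on 3 1 Psi *m act_on 3 2 R) = flip.

Definition qint (q : F) (k : nat) : F := (q ^+ k - q ^- k) / (q - q^-1).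

(* For k = 0 the value is a dummy. *)
Fixpoint skewsymmetrizer (q : F) (R : 'M[F]_(N ^ 2)) (k : nat) : 'M[F]_(N ^ k) :=
  match k with
  | 0 => 1%:M
  | j.+1 =>
      let A := act_on j.+1 1 (skewsymmetrizer q R j) in
      if j == 0%N then 1%:M else
      (qint q j.+1)^-1 *:
        (A *m ((q ^+ j)%:M - qint q j *: Rop R j.+1 j) *m A)
  end.

Fixpoint symmetrizer (q : F) (R : 'M[F]_(N ^ 2)) (k : nat) : 'M[F]_(N ^ k) :=
  match k with
  | 0 => 1%:M
  | j.+1 =>
      let S := act_on j.+1 1 (symmetrizer q R j) in
      if j == 0%N then 1%:M else
      (qint q j.+1)^-1 *:
        (S *m ((q ^- j)%:M + qint q j *: Rop R j.+1 j) *m S)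
  end.

End Braiding.

Section Copies.
Variables (F : fieldType) (K : pzRingType) (iota : {rmorphism F -> K}).
Variables (N : nat) (R : 'M[F]_(N ^ 2)).

(* copy k X i is the i-th copy X_(bar i) on V^(x)k, 1 <= i <= k; iota embeds the
   scalars in the possibly noncommutative ring K. *)
Fixpoint copy (k : nat) (X : 'M[K]_N) (i : nat) : 'M[K]_(N ^ k) :=
  match i with
  | (i'.+1 as j).+1 =>
      map_mx iota (Rop R k j) *m copy k X j *m map_mx iota (invmx (Rop R k j))
  | _ => act_on k 1 (X : 'M[K]_(N ^ 1))
  end.

End Copies.

Section QuantumDouble.
Variables (F : fieldType) (N : nat) (R : 'M[F]_(N ^ 2)).

(* inl (i, j) is m_i^j and inr (i, j) is d_i^j, with i the row index. *)
Definition qd_gen : choiceType := (('I_N * 'I_N) + ('I_N * 'I_N))%type.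

Definition free_M : 'M[freealg F qd_gen]_N :=
  \matrix_(i, j) freegen F (inl (i, j) : qd_gen).
Definition free_D : 'M[freealg F qd_gen]_N :=
  \matrix_(i, j) freegen F (inr (i, j) : qd_gen).

Definition qd_relation (x : freealg F qd_gen) : Prop :=
  let M1 := act_on 2 1 (free_M : 'M_(N ^ 1)) in
  let D1 := act_on 2 1 (free_D : 'M_(N ^ 1)) in
  let r := map_mx (in_alg (freealg F qd_gen)) R in
  let rV := map_mx (in_alg (freealg F qd_gen)) (invmx R) in
  exists i j,
    [\/ x = (r *m M1 *m r *m M1 - M1 *m r *m M1 *m r) i j,
        x = (rV *m D1 *m rV *m D1 - D1 *m rV *m D1 *m rV) i j
      | x = (D1 *m r *m M1 - (r *m M1 *m rV *m D1 *m rV + 1%:M)) i j].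

Definition qdouble : pzRingType := quotalg qd_relation.

Definition qd_const : {rmorphism F -> qdouble} := @quot_const _ _ qd_relation.

Definition Mmx : 'M[qdouble]_N := map_mx (@quot_pi _ _ qd_relation) free_M.
Definition Dmx : 'M[qdouble]_N := map_mx (@quot_pi _ _ qd_relation) free_D.

End QuantumDouble.

(* Main.v *)
Require Import Defs.
From mathcomp Require Import all_boot all_order all_algebra.
From mathcomp Require Import reals complex.
From mathcomp Require Import mxtens zify ring.
Import GRing.Theory.
Local Open Scope ring_scope.

Set Implicit Arguments.
Unset Strict Implicit.
Unset Printing Implicit Defensive.

(** Write r_i for R_i, X_i for the copy X_(bar i), and L_j = M_j D_j, in the
ring of operators on V^(x)k with entries in the quantum double. The only facts
needed are that the r_i are invertible and satisfy the braid and Hecke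
relations, that scalars are central, that M_1 and D_1 commute with r_2, r_3, ...,
and the three quadratic relations between M_1, D_1 and r_1. Everything up to [capelli_hsym] is therefore proved in an
arbitrary ring containing such elements.

One identity implies the other: replacing q by -1/q preserves the Hecke
condition, turns the symmetrizer into the skew-symmetrizer
([skewsymmetrizerE]), changes q^(-j) j_q into -q^j j_q, and changes q^(-k(k-1))
into q^(k(k-1)), the exponent being even. So only the symmetrizers
S^(k) are treated.

Conjugation by r_i r_(i+1) renumbers the copies ([shift_copy],
[shift_copyS]), which carries the relations from index 1 to index i: r_i
commutes with M_i M_(i+1) and with D_(i+1) D_i, and
D_i M_(i+1) = M_(i+1) D_i r_i^(-2) + r_i^(-1). The key consequence
([copy_d_l]) is that if r_i b = q b for j <= i < k, then
  D_j L_k b = (q^(-2) L_k + q^(-1)) D_j b.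
The vector D_j b is still an eigenvector of r_(j+1), ..., r_(k-1), so this can be
iterated, and
  D_j ... D_1 L_k b = (q^(-2j) L_k + q^(-j) j_q) D_j ... D_1 b
([dprod_l]) as soon as r_i b = q b for all i < k. This applies to
b = S^(k), because r_i S^(k) = q S^(k) ([hsym_eigen_idem]), a consequence of the
Yang-Baxter relation for the Baxterized operators ([yang_baxter_eigen]).

The theorem follows by induction on k. Since S^(k) = S^(k) S^(k-1) =
S^(k-1) S^(k) and S^(k-1) commutes with L_k, the induction hypothesis replaces
the first k-1 factors by S^(k-1) M_1 ... M_(k-1) D_(k-1) ... D_1. Moving the D's
through the last factor L_k - q^(-(k-1)) (k-1)_q, which stands in front of
S^(k), the constant term cancels and q^(-2(k-1)) M_k D_k D_(k-1) ... D_1 S^(k)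
remains; finally S^(k) commutes with M_1 ... M_k and with D_k ... D_1.

The rest of the work is to realise the abstract setting by matrices: [act_on]
is multiplicative, composes ([act_on_nested]), and operators acting in disjoint
groups of factors commute ([act_on_comm]). *)

(** * Commutation with inverses, and q-integers *)

Lemma comm_inverse (E : pzRingType) (a b b' : E) :
  b * b' = 1 -> b' * b = 1 -> GRing.comm a b -> GRing.comm a b'.
Proof.
move=> bK b'K ab; rewrite /GRing.comm -[a * b']mul1r -b'K -!mulrA.
by rewrite (mulrA b a) -ab -(mulrA a) bK mulr1.
Qed.

Section QInt.
Variables (F : fieldType) (q : F).
Hypothesis q0 : q != 0.
Hypothesis qint_neq0 : forall k : nat, (1 <= k)%N -> qint q k != 0.

Lemma qint0 : qint q 0 = 0.
Proof. by rewrite /qint expr0 invr1 subrr mul0r. Qed.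

Lemma qintS k : qint q k.+1 = q * qint q k + q ^- k.
Proof.
have qq : q - q^-1 != 0.
  by have := qint_neq0 (leqnn 1); rewrite /qint mulf_eq0 invr_eq0 negb_or => /andP[].
have qk : q ^+ k != 0 by rewrite expf_neq0.
rewrite /qint exprS; field.
have -> : q * q - 1 = q * (q - q^-1) by field.
by rewrite q0 qk mulf_neq0.
Qed.
End QInt.

(** * The Yang-Baxter step for symmetrizers *)

Section YangBaxter.
Variables (F : fieldType) (E : pzRingType) (iota : {rmorphism F -> E}).
Hypothesis iotaC : forall a x, iota a * x = x * iota a.
Variable q : F.
Hypothesis q0 : q != 0.

(** Here a = r_(k-1), b = r_k and S = S^(k); with al = q^(-(k-1)) and
    p = (k-1)_q, the two factors are, up to scalars, those that build S^(k) and
    S^(k+1). *)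
Lemma yang_baxter_eigen (a b S : E) (al p : F) :
    b * b = 1 + iota (q - q^-1) * b -> b * a * b = a * b * a ->
    a * S = iota q * S ->
  let v := (iota al + iota p * a) * (iota (al / q) + iota (q * p + al) * b) * S in
  b * v = iota q * v.
Proof.
move=> bb bab aS v.
have iM x y z : iota x * (iota y * z) = iota (x * y) * z by rewrite mulrA rmorphM.
have iL y x z : y * (iota x * z) = iota x * (y * z) by rewrite mulrA -iotaC -mulrA.
have La := iL a; have Lb := iL b.
have bbS y : b * (b * y) = y + iota (q - q^-1) * (b * y).
  by rewrite mulrA bb mulrDl mul1r mulrA.
have babS : b * (a * (b * S)) = iota q * (a * (b * S)).
  by rewrite !mulrA bab -!mulrA aS Lb.
(* The span of S, b S and a b S is stable under b; coefficients are compared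
   in this spanning family. *)
have expand x y z w : (iota x + iota y * a) * (iota z + iota w * b) * S =
    iota (x * z + y * z * q) * S +
      (iota (x * w) * (b * S) + iota (y * w) * (a * (b * S))).
  rewrite -mulrA (mulrDl _ _ S) -!mulrA mulrDl !mulrDr -!mulrA !La aS !iM.
  rewrite rmorphD /= mulrDl -!addrA; congr (_ + _).
  rewrite addrCA; congr (iota _ * _ + _); ring.
have act x y z :
    b * (iota x * S + (iota y * (b * S) + iota z * (a * (b * S)))) =
    iota y * S + (iota (x + y * (q - q^-1)) * (b * S) +
                  iota (z * q) * (a * (b * S))).
  rewrite !(mulrDr b) !Lb babS bbS (mulrDr (iota y)) !iM.
  by rewrite [in RHS]rmorphD /= mulrDl -!addrA (addrCA _ (iota y * S)).
rewrite /v expand act !mulrDr !iM.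
by congr (iota _ * _ + (iota _ * _ + iota _ * _)); field.
Qed.

End YangBaxter.

(** * Copies of an element along a braid representation *)

Section Copies.
Variables (E : pzRingType) (n : nat) (r r' : nat -> E).
Hypothesis rK : forall i, (0 < i < n)%N -> r i * r' i = 1.
Hypothesis r'K : forall i, (0 < i < n)%N -> r' i * r i = 1.
Hypothesis braid : forall i, (0 < i)%N -> (i.+1 < n)%N ->
  r i * r i.+1 * r i = r i.+1 * r i * r i.+1.
Hypothesis far : forall i j, (0 < i)%N -> (i.+1 < j)%N -> (j < n)%N ->
  GRing.comm (r i) (r j).

(** The copies X_1 = x, X_(j+1) = r_j X_j r_j^(-1); index 0 is a dummy with
    value x. *)
Fixpoint braid_copy (x : E) (j : nat) : E :=
  match j with
  | (j'.+1 as i).+1 => r i * braid_copy x i * r' i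
  | _ => x
  end.
Local Notation cp := braid_copy.

Lemma braid_copyS x j : (0 < j)%N -> cp x j.+1 = r j * cp x j * r' j.
Proof. by case: j. Qed.

Lemma braid_copy0 x : cp x 0 = x. Proof. by []. Qed.
Lemma braid_copy1 x : cp x 1 = x. Proof. by []. Qed.

(* Otherwise rewriting with mulrA and the like looks for products inside the
   unfolded copies. *)
#[local] Opaque braid_copy.

Lemma r_copyS x j : (0 < j < n)%N -> cp x j.+1 * r j = r j * cp x j.
Proof. by move=> hj; rewrite braid_copyS -?mulrA ?r'K ?mulr1//; lia. Qed.

Lemma r'_copyS x j : (0 < j < n)%N -> r' j * cp x j.+1 = cp x j * r' j.
Proof. by move=> hj; rewrite braid_copyS ?mulrA ?r'K ?mul1r//; lia. Qed.

Lemma braid_copyM x y j : (0 < j <= n)%N -> cp (x * y) j = cp x j * cp y j.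
Proof.
elim: j => [//|[|j] IHj] hj; first by rewrite !braid_copy1.
rewrite !(@braid_copyS _ j.+1)// IHj; last by lia.
by rewrite -!mulrA; congr (_ * (_ * _)); rewrite mulrA r'K ?mul1r//; lia.
Qed.

(** Conjugation by r_i r_(i+1). It sends r_i, X_i and X_(i+1) to r_(i+1),
    X_(i+1) and X_(i+2) when x commutes with r_2, r_3, ... *)
Definition shift i z := r i * r i.+1 * z * (r' i.+1 * r' i).

Lemma shiftP i y z : (0 < i)%N -> (i.+1 < n)%N ->
  r i * r i.+1 * y = z * (r i * r i.+1) -> shift i y = z.
Proof.
move=> i0 hi e; rewrite /shift e -!mulrA (mulrA (r i.+1)).
by rewrite rK ?mul1r ?rK ?mulr1//; lia.
Qed.

Lemma shift1 i : (0 < i)%N -> (i.+1 < n)%N -> shift i 1 = 1.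
Proof. by move=> i0 hi; apply: shiftP => //; rewrite mulr1 mul1r. Qed.

Lemma shiftD i y z : shift i (y + z) = shift i y + shift i z.
Proof. by rewrite /shift mulrDr mulrDl. Qed.

Lemma shiftM i y z : (0 < i)%N -> (i.+1 < n)%N ->
  shift i (y * z) = shift i y * shift i z.
Proof.
move=> i0 hi; rewrite /shift -!mulrA (mulrA (r' i)) r'K ?mul1r; last by lia.
by rewrite (mulrA (r' i.+1)) r'K ?mul1r//; lia.
Qed.

Lemma shift_r i : (0 < i)%N -> (i.+1 < n)%N -> shift i (r i) = r i.+1.
Proof. by move=> i0 hi; apply: shiftP => //; rewrite braid// mulrA. Qed.

Lemma shift_r' i : (0 < i)%N -> (i.+1 < n)%N -> shift i (r' i) = r' i.+1.
Proof.
move=> i0 hi; rewrite -[LHS]mul1r -(@r'K i.+1)// -[RHS]mulr1 -mulrA.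
by rewrite -(shift_r i0 hi) -shiftM// rK ?shift1//; lia.
Qed.

Lemma braid_inv i : (0 < i)%N -> (i.+1 < n)%N ->
  r i.+1 * (r' i * r' i.+1) = r' i * r' i.+1 * r i.
Proof.
move=> i0 iN.
have hi : (0 < i < n)%N by lia.
have hj : (0 < i.+1 < n)%N by lia.
have := braid i0 iN => /(congr1 (fun z => r' i * (r' i.+1 * z) * (r' i * r' i.+1))).
rewrite -!mulrA (mulrA (r i) (r' i)) rK// mul1r rK// mulr1.
rewrite (mulrA (r' i.+1) (r i.+1)) r'K// mul1r (mulrA (r' i) (r i)) r'K// mul1r.
by move=> ->; rewrite !mulrA.
Qed.

Section CommutingElement.
Variable x : E.
Hypothesis rx : forall i, (1 < i < n)%N -> GRing.comm (r i) x.

(** X_j commutes with r_i for every i other than j-1 and j: the case i > j is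
    [comm_copy_lt], the case i < j-1 is [comm_copy_gt]. *)
Lemma comm_copy_lt i j : (0 < j < i)%N -> (i < n)%N -> GRing.comm (r i) (cp x j).
Proof.
elim: j => [//|[|j] IHj] hj hi; first by rewrite braid_copy1; apply: rx; lia.
have cij : GRing.comm (r i) (r j.+1) by apply: commr_sym; apply: far; lia.
rewrite braid_copyS//; apply: commrM; first apply: commrM => //.
  by apply: IHj; lia.
by apply: (@comm_inverse _ _ (r j.+1)) => //; [apply: rK | apply: r'K]; lia.
Qed.

Lemma comm_copy_gt i j : (0 < i)%N -> (i.+1 < j <= n)%N ->
  GRing.comm (r i) (cp x j).
Proof.
move=> i0; elim: j => [//|j IHj] hj.
have hj' : (0 < j < n)%N by lia.
have [eij|nij] := eqVneq i.+1 j.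
  (* r_i r_(i+1) r_i X_i = r_(i+1) r_i X_i r_(i+1), and r_(i+1) then passes
     through r_i^(-1) r_(i+1)^(-1) and becomes r_i. *)
  subst j; rewrite !braid_copyS// /GRing.comm !mulrA braid//.
  have cX : r i.+1 * cp x i = cp x i * r i.+1 by apply: comm_copy_lt; lia.
  have e := @braid_inv i i0 ltac:(lia); rewrite -!mulrA in e *.
  by rewrite -e !mulrA -(mulrA _ (r i.+1) (cp x i)) cX !mulrA.
have cij : GRing.comm (r i) (r j) by apply: far; lia.
rewrite braid_copyS; last by lia.
apply: commrM; first apply: commrM => //.
  by apply: IHj; lia.
by apply: (@comm_inverse _ _ (r j)) => //; [apply: rK | apply: r'K]; lia.
Qed.

Lemma shift_copy i : (0 < i)%N -> (i.+1 < n)%N -> shift i (cp x i) = cp x i.+1.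
Proof.
move=> i0 hi; apply: shiftP => //; rewrite -mulrA comm_copy_lt//; last by lia.
by rewrite !mulrA r_copyS//; lia.
Qed.

Lemma shift_copyS i : (0 < i)%N -> (i.+1 < n)%N ->
  shift i (cp x i.+1) = cp x i.+2.
Proof.
move=> i0 hi; apply: shiftP => //; rewrite -mulrA -r_copyS; last by lia.
by rewrite mulrA comm_copy_gt//; [rewrite mulrA | lia].
Qed.

End CommutingElement.

(** * The quadratic relations between copies *)

Section Double.
Variables m d : E.
Hypothesis rm : forall i, (1 < i < n)%N -> GRing.comm (r i) m.
Hypothesis rd : forall i, (1 < i < n)%N -> GRing.comm (r i) d.
Hypothesis mm1 : (1 < n)%N -> r 1 * m * r 1 * m = m * r 1 * m * r 1.
Hypothesis dd1 : (1 < n)%N -> r' 1 * d * r' 1 * d = d * r' 1 * d * r' 1.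
Hypothesis dm1 : (1 < n)%N -> d * r 1 * m = r 1 * m * r' 1 * d * r' 1 + 1.

Lemma copy_mm i : (0 < i < n)%N -> GRing.comm (r i) (cp m i * cp m i.+1).
Proof.
elim: i => [//|[|i] IHi] hi.
  rewrite /GRing.comm (@braid_copyS _ 1)// !braid_copy1 -!mulrA r'K// mulr1 !mulrA mm1//.
  by rewrite -!mulrA rK ?mulr1.
have := IHi ltac:(lia); rewrite /GRing.comm => /(congr1 (shift i.+1)).
rewrite (shiftM (r _))// (shiftM _ (r _))// (shiftM (cp _ _))// shift_r//.
by rewrite !shift_copy// !shift_copyS.
Qed.

Lemma copy_dd i : (0 < i < n)%N -> GRing.comm (r i) (cp d i.+1 * cp d i).
Proof.
elim: i => [//|[|i] IHi] hi.
  rewrite /GRing.comm (@braid_copyS _ 1)// !braid_copy1 -!mulrA; congr (_ * _).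
  have := dd1 hi => /(congr1 (fun z => r 1 * z * r 1)).
  by rewrite -!mulrA r'K// mulr1 (mulrA (r 1)) rK// mul1r => ->.
have := IHi ltac:(lia); rewrite /GRing.comm => /(congr1 (shift i.+1)).
rewrite (shiftM (r _))// (shiftM _ (r _))// (shiftM (cp _ _))// shift_r//.
by rewrite !shift_copy// !shift_copyS.
Qed.

Lemma copy_dm i : (0 < i < n)%N ->
  cp d i * cp m i.+1 = cp m i.+1 * cp d i * r' i * r' i + r' i.
Proof.
elim: i => [//|[|i] IHi] hi.
  by rewrite !(@braid_copyS _ 1)// !braid_copy1 !mulrA dm1// mulrDl mul1r.
have := IHi ltac:(lia) => /(congr1 (shift i.+1)).
rewrite shiftD (shiftM _ (r' _))// (shiftM _ (r' _))//.
rewrite (shiftM (cp d _))// (shiftM (cp m _))// !shift_r'//.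
by rewrite !shift_copy// !shift_copyS.
Qed.

Lemma copy_drd i : (0 < i < n)%N ->
  cp d i * r' i * cp d i = r' i * cp d i.+1 * cp d i.
Proof. by move=> hi; rewrite -r'_copyS. Qed.

Local Notation l := (m * d).

(** D_j passes through L_k = M_k D_k in front of an element b on which
    r_j, ..., r_(k-1) act by the scalar s, whose inverse s' is central. The
    proof is by induction on k: L_(k+1) is conjugate to L_k by r_k, which
    commutes with D_j when j < k. *)
Lemma copy_d_l (s s' b : E) j k :
    (forall x, GRing.comm s' x) -> s' * s = 1 -> (0 < j < k)%N -> (k <= n)%N ->
    (forall i, (j <= i < k)%N -> r i * b = s * b) ->
  cp d j * (cp l k * b) = (s' * s' * cp l k + s') * (cp d j * b).
Proof.
move=> s'C s'K; elim: k => [|k IHk] hj hk rb; first by lia.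
have s'V y : s' * y = y * s' by apply: s'C.
have r'b i : (j <= i < k.+1)%N -> r' i * b = s' * b.
  move=> hi; have e : b = s' * (r i * b) by rewrite rb// mulrA s'K mul1r.
  by rewrite {1}e mulrA -s'V -mulrA (mulrA (r' i)) r'K ?mul1r//; lia.
have hk' : (0 < k < n)%N by lia.
have [ejk|njk] := eqVneq j k.
  (* D_j M_(j+1) D_(j+1) b = M_(j+1) D_j r_j^(-2) D_(j+1) b + r_j^(-1) D_(j+1) b,
     where r_j^(-1) D_(j+1) = D_j r_j^(-1). *)
  move: hj hk rb r'b hk'; rewrite -{}ejk => hj hk rb r'b hk'.
  rewrite braid_copyM; last by lia.
  have e1 : r' j * (cp d j.+1 * b) = s' * (cp d j * b).
    by rewrite mulrA r'_copyS// -mulrA r'b ?leqnn// mulrA -s'V -mulrA.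
  have e2 : cp d j * (r' j * (r' j * (cp d j.+1 * b))) =
      s' * (s' * (cp d j.+1 * (cp d j * b))).
    have cdd : GRing.comm (cp d j.+1 * cp d j) (r' j).
      apply: (@comm_inverse _ _ (r j)); [exact: rK | exact: r'K |].
      by apply: commr_sym; apply: copy_dd.
    rewrite e1 (mulrA (r' j)) -s'V -mulrA (mulrA (cp d j)) -s'V -mulrA.
    congr (s' * _); rewrite !mulrA copy_drd// -(mulrA (r' j)) -cdd.
    by rewrite -!mulrA r'b ?leqnn// (mulrA (cp d j) s') -s'V !mulrA s'V.
  rewrite !mulrA copy_dm// !mulrDl -!mulrA e2 e1; congr (_ + _).
  by rewrite !mulrA -!s'V !mulrA.
rewrite braid_copyS; last by lia.
have rd1 : r k * cp d j = cp d j * r k by apply: (comm_copy_lt rd); lia.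
have rd2 : r' k * cp d j = cp d j * r' k.
  apply: commr_sym; apply: (@comm_inverse _ _ (r k)); [exact: rK | exact: r'K |].
  exact: commr_sym.
have {}IHk : cp d j * (cp l k * b) = (s' * s' * cp l k + s') * (cp d j * b).
  by apply: IHk; try lia; move=> i hi; apply: rb; lia.
have r'db : r' k * (cp d j * b) = s' * (cp d j * b).
  by rewrite mulrA rd2 -mulrA r'b ?mulrA ?s'V//; lia.
transitivity (s' * (r k * (cp d j * (cp l k * b)))).
  rewrite -!mulrA r'b; last by lia.
  by rewrite (mulrA (r k) (cp d j)) rd1 -mulrA; do 3 rewrite (mulrA _ s') -s'V -mulrA.
rewrite IHk !mulrDl !mulrDr -!mulrA r'db; congr (_ + _).
  do 2 rewrite (mulrA (r k) s') -s'V -mulrA.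
  by rewrite (mulrA _ s' (cp d j * b)) -s'V -mulrA (mulrA (r k) s') -s'V -mulrA.
by rewrite -r'db (mulrA (r k)) rK// mul1r.
Qed.

(** * Symmetrizers and the identity in an abstract ring *)

Section Capelli.
Variables (F : fieldType) (iota : {rmorphism F -> E}).
Hypothesis iotaC : forall a x, iota a * x = x * iota a.
Variable q : F.
Hypothesis q0 : q != 0.
Hypothesis qint_neq0 : forall k : nat, (1 <= k)%N -> qint q k != 0.
Hypothesis hecke : forall i, (0 < i < n)%N ->
  r i * r i = 1 + iota (q - q^-1) * r i.

(** The symmetrizer S^(k) as an element of the ring; hsym 0 = hsym 1 = 1. *)
Fixpoint hsym (k : nat) : E :=
  match k with
  | 0 => 1
  | j.+1 =>
      if j == 0%N then 1 else
      iota (qint q j.+1)^-1 *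
        (hsym j * (iota (q ^- j) + iota (qint q j) * r j) * hsym j)
  end.

Lemma hsym0 : hsym 0 = 1. Proof. by []. Qed.
Lemma hsym1 : hsym 1 = 1. Proof. by []. Qed.

Lemma hsymS k : (0 < k)%N ->
  hsym k.+1 = iota (qint q k.+1)^-1 *
    (hsym k * (iota (q ^- k) + iota (qint q k) * r k) * hsym k).
Proof. by case: k. Qed.

#[local] Opaque hsym.

Lemma iota_mulA a b x : iota a * (iota b * x) = iota (a * b) * x.
Proof. by rewrite mulrA rmorphM. Qed.

Lemma iota_mulCA a x y : x * (iota a * y) = iota a * (x * y).
Proof. by rewrite mulrA -iotaC -mulrA. Qed.

Lemma comm_hsym x k : (forall i, (0 < i < k)%N -> GRing.comm x (r i)) ->
  GRing.comm x (hsym k).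
Proof.
elim: k => [|[|k] IHk] hx; rewrite ?hsym0 ?hsym1; do ?exact: commr1.
rewrite hsymS//; have {}IHk := IHk (fun i hi => hx i ltac:(lia)).
have ci a : GRing.comm x (iota a) by rewrite /GRing.comm iotaC.
apply: commrM => //; apply: commrM => //; apply: commrM => //.
by apply: commrD => //; apply: commrM => //; apply: hx; lia.
Qed.

Lemma hsym_absorbl k : hsym k * hsym k = hsym k -> hsym k * hsym k.+1 = hsym k.+1.
Proof.
case: k => [|k] Ik; first by rewrite hsym0 mul1r.
by rewrite (@hsymS k.+1)// iota_mulCA !(mulrA (hsym _)) Ik.
Qed.

Lemma hsym_absorbr k : hsym k * hsym k = hsym k -> hsym k.+1 * hsym k = hsym k.+1.
Proof.
case: k => [|k] Ik; first by rewrite hsym0 mulr1.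
by rewrite (@hsymS k.+1)// -!mulrA Ik.
Qed.

(** Both claims are proved together: idempotency of S^(k-1) allows expanding one
    factor S^(k) in the proof that r_k S^(k+1) = q S^(k+1), and the eigenvector
    property gives idempotency. *)
Lemma hsym_eigen_idem k : (k <= n)%N ->
  (forall i, (0 < i < k)%N -> r i * hsym k = iota q * hsym k) /\
  hsym k * hsym k = hsym k.
Proof.
elim/ltn_ind: k => -[|[|k]] IHk kn.
- by split=> [i|]; [lia | rewrite ?hsym0 ?hsym1 mulr1].
- by split=> [i|]; [lia | rewrite ?hsym0 ?hsym1 mulr1].
have [Pk Ik] := IHk k.+1 ltac:(lia) ltac:(lia).
have P i : (0 < i < k.+2)%N -> r i * hsym k.+2 = iota q * hsym k.+2.
  move=> hi; rewrite hsymS// iota_mulCA [RHS]iota_mulCA; congr (_ * _).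
  have [ik|ki] := ltnP i k.+1.
    by rewrite -mulrA (mulrA (r i)) Pk -?mulrA//; lia.
  have -> : i = k.+1 by lia.
  have rr : r k.+1 * r k.+1 = 1 + iota (q - q^-1) * r k.+1 by apply: hecke; lia.
  case: k {hi ki i} => [|k] in kn Pk Ik rr IHk *.
    rewrite hsym1 mul1r mulr1 qintS// qint0 mulr0 expr0 invr1 !add0r rmorph1 mul1r.
    rewrite !mulrDr -(iotaC q^-1) rr -rmorphM divff// rmorph1 rmorphB mulrBl.
    by rewrite addrCA (addrC (_ * r 1)) subrK.
  have [_ Ij] := IHk k.+1 ltac:(lia) ltac:(lia).
  have cr : hsym k.+1 * r k.+2 = r k.+2 * hsym k.+1.
    by apply/commr_sym/comm_hsym => i hi; apply/commr_sym/far; lia.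
  set X := iota (q ^- k.+2) + iota (qint q k.+2) * r k.+2.
  have cX : hsym k.+1 * X = X * hsym k.+1.
    by rewrite /X mulrDr mulrDl (iotaC (q ^- k.+2)) iota_mulCA cr mulrA.
  (* Expand the left factor only, and absorb the S^(k+1) it produces on the
     right into the other factor. *)
  have -> : hsym k.+2 * X * hsym k.+2 = iota (qint q k.+2)^-1 * (hsym k.+1 *
     ((iota (q ^- k.+1) + iota (qint q k.+1) * r k.+1) * X * hsym k.+2)).
    rewrite [in hsym k.+2 * X](@hsymS k.+1)// -!mulrA (mulrA _ X) cX -mulrA.
    by rewrite hsym_absorbl.
  rewrite iota_mulCA [RHS]iota_mulCA; congr (_ * _).
  rewrite mulrA -cr -mulrA -(iota_mulCA q); congr (_ * _).
  have -> : X = iota (q ^- k.+1 / q) + iota (q * qint q k.+1 + q ^- k.+1) * r k.+2.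
    by rewrite /X qintS// [in LHS]exprSr invfM mulrC.
  apply: yang_baxter_eigen => //.
    by rewrite braid//.
  by apply: Pk; lia.
split=> //.
rewrite [in X in X * _ = _](@hsymS k.+1)//.
move: (hsym_absorbl Ik) (P k.+1 (leqnn _)); move: (hsym k.+2) => H aH rH.
rewrite -!mulrA aH mulrDl -mulrA rH iota_mulA -mulrDl -rmorphD iota_mulCA aH.
rewrite iota_mulA [_ * q]mulrC [_ + q * _]addrC -qintS// mulVf ?rmorph1 ?mul1r//.
exact: qint_neq0.
Qed.

(** The products D_k ... D_1 and M_1 ... M_k. *)
Definition dprod k := \prod_(j <- rev (index_iota 1 k.+1)) cp d j.
Definition mprod k := \prod_(1 <= j < k.+1) cp m j.

Lemma dprod0 : dprod 0 = 1. Proof. by rewrite /dprod big_nil. Qed.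
Lemma dprodS k : dprod k.+1 = cp d k.+1 * dprod k.
Proof.
rewrite /dprod /index_iota !subSS !subn0 -[in LHS](addn1 k) iotaD rev_cat.
by rewrite big_cat big_seq1 add1n.
Qed.
Lemma mprodS k : mprod k.+1 = mprod k * cp m k.+1.
Proof. by rewrite /mprod big_nat_recr. Qed.

Lemma comm_dprod_lt i k : (k < i < n)%N -> GRing.comm (r i) (dprod k).
Proof.
elim: k => [|k IHk] hk; first by rewrite dprod0; apply: commr1.
by rewrite dprodS; apply: commrM; [apply: comm_copy_lt => //; lia | apply: IHk; lia].
Qed.

Lemma comm_mprod_lt i k : (k < i < n)%N -> GRing.comm (r i) (mprod k).
Proof.
elim: k => [|k IHk] hk; first by rewrite /mprod big_geq//; apply: commr1.
by rewrite mprodS; apply: commrM; [apply: IHk; lia | apply: comm_copy_lt => //; lia].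
Qed.

Lemma comm_dprod i k : (0 < i < k)%N -> (k <= n)%N -> GRing.comm (r i) (dprod k).
Proof.
elim: k => [|k IHk] hi hk; first by lia.
have [ik|ki] := ltnP i k.
  rewrite dprodS; apply: commrM; last by apply: IHk; lia.
  by apply: comm_copy_gt => //; lia.
case: k => [|k] in hi hk IHk ki *; first by lia.
have -> : i = k.+1 by lia.
rewrite !dprodS mulrA; apply: commrM; first by apply: copy_dd; lia.
by apply: comm_dprod_lt; lia.
Qed.

Lemma comm_mprod i k : (0 < i < k)%N -> (k <= n)%N -> GRing.comm (r i) (mprod k).
Proof.
elim: k => [|k IHk] hi hk; first by lia.
have [ik|ki] := ltnP i k.
  rewrite mprodS; apply: commrM; first by apply: IHk; lia.
  by apply: comm_copy_gt => //; lia.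
case: k => [|k] in hi hk IHk ki *; first by lia.
have -> : i = k.+1 by lia.
rewrite !mprodS -mulrA; apply: commrM; last by apply: copy_mm; lia.
by apply: comm_mprod_lt; lia.
Qed.

(** Iterating [copy_d_l]; the constant term obeys
    q^(-2j-1) + q^(-j) j_q = q^(-(j+1)) (j+1)_q. *)
Lemma dprod_l (b : E) j k : (j < k)%N -> (k <= n)%N ->
    (forall i, (0 < i < k)%N -> r i * b = iota q * b) ->
  dprod j * (cp l k * b) =
  (iota (q ^- (2 * j)) * cp l k + iota (q ^- j * qint q j)) * (dprod j * b).
Proof.
move=> + kn rb; elim: j => [|j IHj] jk.
  by rewrite dprod0 !mul1r muln0 expr0 invr1 qint0 mulr0 rmorph1 rmorph0 addr0 !mul1r.
rewrite dprodS -!mulrA IHj; last by lia.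
have rdb i : (j.+1 <= i < k)%N -> r i * (dprod j * b) = iota q * (dprod j * b).
  move=> hi; rewrite mulrA comm_dprod_lt; last by lia.
  by rewrite -mulrA rb ?iota_mulCA//; lia.
have iq : iota q^-1 * iota q = 1 by rewrite -rmorphM mulVf ?rmorph1.
have iC x : GRing.comm (iota q^-1) x by apply: iotaC.
have hj : (0 < j.+1 < k)%N by lia.
have := copy_d_l iC iq hj kn rdb.
move: (cp l k) (cp d j.+1) (dprod j * b) => L D B DL.
rewrite mulrDl mulrDr -mulrA !iota_mulCA DL mulrDl mulrDr -!rmorphM -!mulrA.
rewrite !iota_mulA -addrA -mulrDl -rmorphD mulrDl -!mulrA.
congr (iota _ * _ + iota _ * _).
  by rewrite mulnS exprD; field; rewrite q0 expf_neq0.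
by rewrite qintS// mul2n -addnn exprD exprS; field; rewrite q0 expf_neq0.
Qed.

(** The symmetrizer identity for elements of an abstract ring. *)
Theorem capelli_hsym k : (0 < k <= n)%N ->
  hsym k * (\prod_(1 <= j < k.+1) (cp l j - iota (q ^- j.-1 * qint q j.-1)))
    * hsym k = iota (q ^- (k * k.-1)) * hsym k * (mprod k * dprod k).
Proof.
elim: k => [//|[|k] IHk] hk.
  rewrite hsym1 !mulr1 !mul1r big_nat1 mul1n /= expr0 invr1 rmorph1 !mul1r.
  rewrite qint0 ?mulr0 rmorph0 subr0 dprodS dprod0 mulr1 mprodS /mprod big_geq//.
  by rewrite mul1r braid_copyM.
move: hk => /andP[_ hk].
have {}IHk := IHk ltac:(lia).
have [eH iH] := hsym_eigen_idem hk.
have [_ iH'] := @hsym_eigen_idem k.+1 ltac:(lia).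
have cHm : hsym k.+2 * mprod k.+2 = mprod k.+2 * hsym k.+2.
  by apply/commr_sym/comm_hsym => i hi; apply/commr_sym/comm_mprod.
have cHd : hsym k.+2 * dprod k.+2 = dprod k.+2 * hsym k.+2.
  by apply/commr_sym/comm_hsym => i hi; apply/commr_sym/comm_dprod.
have cHl : hsym k.+1 * cp l k.+2 = cp l k.+2 * hsym k.+1.
  apply/commr_sym/comm_hsym => i hi; apply/commr_sym/comm_copy_gt => //; last by lia.
    by move=> p hp; apply: commrM; [apply: rm | apply: rd].
  by lia.
have aHl := hsym_absorbl iH'; have aHr := hsym_absorbr iH'.
have DL := @dprod_l (hsym k.+2) k.+1 k.+2 (leqnn _) hk eH.
rewrite big_nat_recr//=.
have Lk : cp l k.+2 = cp m k.+2 * cp d k.+2 by rewrite braid_copyM.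
move: cHm cHd; rewrite dprodS mprodS -/(mprod k.+1) -/(dprod k.+1).
move: IHk DL aHl aHr cHl iH Lk; rewrite -pred_Sn.
move: (\prod_(1 <= i < _) _) (mprod k.+1) (dprod k.+1) => P Mp Dp.
move: (hsym k.+1) (hsym k.+2) (cp l k.+2) (cp m k.+2) (cp d k.+2) => H' H L M D.
move=> IHk DL aHl aHr cHl iH Lk cHm cHd.
set c := iota (q ^- k.+1 * _).
have cHL : H' * (L - c) = (L - c) * H' by rewrite mulrBr mulrBl cHl /c iotaC.
transitivity (H * (H' * P * H') * ((L - c) * H)).
  by rewrite -!mulrA (mulrA H' (L - c)) cHL -!mulrA aHl (mulrA H H') aHr.
(* The constant term of dprod_l is exactly c. *)
have {}DL : Dp * ((L - c) * H) = iota (q ^- (2 * k.+1)) * (L * (Dp * H)).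
  by rewrite mulrBl mulrBr /c iota_mulCA DL mulrDl addrK -mulrA.
rewrite IHk -!mulrA DL (iota_mulCA _ Mp) (iota_mulCA _ H') iota_mulA.
rewrite (iota_mulCA _ H) (mulrA H H') aHr Lk.
have -> : H * (Mp * (M * D * (Dp * H))) = H * (Mp * (M * (D * Dp))).
  by rewrite -!mulrA (mulrA D) -cHd (mulrA M) (mulrA Mp) -!mulrA (mulrA Mp) (mulrA (Mp * M)) -cHm !mulrA iH.
by congr (iota _ * _); rewrite -invfM -exprD; congr (q ^- _); lia.
Qed.

End Capelli.
End Double.
End Copies.

(** * Kronecker products up to equality of sizes *)

Section Cast.
Variable K : pzRingType.

(** A square matrix seen at another size; this is a transport when the two sizes
    are equal and 0 otherwise. *)
Definition resize (p q : nat) (A : 'M[K]_p) : 'M[K]_q := conform_mx 0 A.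
Arguments resize {p} q A.

Lemma resize_id p (A : 'M[K]_p) : resize p A = A.
Proof. exact: conform_mx_id. Qed.

Lemma resize_resize p q n (A : 'M[K]_p) : p = q -> resize n (resize q A) = resize n A.
Proof. by move=> <-; rewrite resize_id. Qed.

Lemma resize1 p q : p = q -> resize q (1%:M : 'M[K]_p) = 1%:M.
Proof. by move=> <-; rewrite resize_id. Qed.

Lemma resizeM p q (A B : 'M[K]_p) : p = q ->
  resize q (A *m B) = resize q A *m resize q B.
Proof. by move=> <-; rewrite !resize_id. Qed.

Lemma resizeD p q (A B : 'M[K]_p) : p = q ->
  resize q (A + B) = resize q A + resize q B.
Proof. by move=> <-; rewrite !resize_id. Qed.

Lemma resize_tensl p q s (A : 'M[K]_p) (B : 'M[K]_s) : p = q ->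
  resize q A *t B = resize (q * s) (A *t B).
Proof. by move=> <-; rewrite !resize_id. Qed.

Lemma resize_tensr p q s (A : 'M[K]_p) (B : 'M[K]_s) : p = q ->
  B *t resize q A = resize (s * q) (B *t A).
Proof. by move=> <-; rewrite !resize_id. Qed.

Lemma resizeE p q (e : p = q) (A : 'M[K]_p) i j :
  resize q A i j = A (cast_ord (esym e) i) (cast_ord (esym e) j).
Proof. by case: q / e i j => i j; rewrite resize_id !cast_ord_id. Qed.

Lemma tensmxA p q s (A : 'M[K]_p) (B : 'M[K]_q) (C : 'M[K]_s) :
  A *t (B *t C) = resize (p * (q * s)) (A *t B *t C).
Proof.
have e : (p * q * s = p * (q * s))%N by rewrite mulnA.
apply/matrixP => i j; rewrite (resizeE e).
case: (mxtens_indexP i) => i1 i'; case: (mxtens_indexP i') => i2 i3.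
case: (mxtens_indexP j) => j1 j'; case: (mxtens_indexP j') => j2 j3.
have ce (a : 'I_p) b c : cast_ord (esym e) (mxtens_index (a, mxtens_index (b, c))) =
    mxtens_index (mxtens_index (a, b), c).
  by apply: val_inj; rewrite /= mulnDl addnA mulnA.
by rewrite !ce !tensmxE mulrA.
Qed.

Lemma tensmx11 p q : (1%:M : 'M[K]_p) *t (1%:M : 'M[K]_q) = 1%:M.
Proof.
apply/matrixP => i j.
case: (mxtens_indexP i) => i1 i2; case: (mxtens_indexP j) => j1 j2.
rewrite tensmxE !mxE -natrM mulnb; congr (_%:R); congr nat_of_bool.
apply/andP/eqP => [[/eqP -> /eqP ->] // | e].
by have := congr1 (@mxtens_unindex _ _) e; rewrite !mxtens_indexK => -[-> ->].
Qed.

(** The mixed product rule, over a ring that need not be commutative. *)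
Lemma tensmx_mul_comm m n p q s t
    (A : 'M[K]_(m, n)) (B : 'M[K]_(p, q)) (C : 'M[K]_(n, s)) (D : 'M[K]_(q, t)) :
    (forall i j k l, GRing.comm (B i j) (C k l)) ->
  (A *t B) *m (C *t D) = (A *m C) *t (B *m D).
Proof.
move=> BC; apply/matrixP => i j.
case: (mxtens_indexP i) => i1 i2; case: (mxtens_indexP j) => j1 j2.
rewrite !mxE !mxtens_indexK mulr_sum; apply: eq_bigr => k _.
rewrite !mxE !mxtens_indexK -!mulrA; congr (_ * _).
by rewrite !mulrA (BC i2).
Qed.

Lemma tensmx_nest a b s c d q (X : 'M[K]_s) :
  resize q ((1%:M : 'M_a) *t ((1%:M : 'M_b) *t X *t (1%:M : 'M_c))
              *t (1%:M : 'M_d)) =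
  resize q ((1%:M : 'M_(a * b)) *t X *t (1%:M : 'M_(c * d))).
Proof.
have e1 : (a * b * s = a * (b * s))%N by rewrite mulnA.
rewrite tensmxA (tensmxA _ _ X) tensmx11 (resize_tensl _ _ e1).
rewrite resize_resize; last by rewrite !mulnA.
rewrite resize_tensl ?resize_resize; try by rewrite !mulnA.
by rewrite -(tensmx11 c d) tensmxA resize_resize// !mulnA.
Qed.

Lemma comm_mx1 n i j (x : K) : GRing.comm x ((1%:M : 'M[K]_n) i j).
Proof. by rewrite mxE; case: (i == j); [apply: commr1 | apply: commr0]. Qed.

Lemma tens1mx p (A : 'M[K]_p) : (1%:M : 'M[K]_1) *t A = resize (1 * p) A.
Proof.
have e : (p = 1 * p)%N by rewrite mul1n.
apply/matrixP => i j; rewrite (resizeE e).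
case: (mxtens_indexP i) => i1 i2; case: (mxtens_indexP j) => j1 j2.
rewrite tensmxE !ord1 mxE mul1r.
by congr (A _ _); apply: val_inj; rewrite /= mul0n.
Qed.

Lemma tensmx1 p (A : 'M[K]_p) : A *t (1%:M : 'M[K]_1) = resize (p * 1) A.
Proof.
have e : (p = p * 1)%N by rewrite muln1.
apply/matrixP => i j; rewrite (resizeE e).
case: (mxtens_indexP i) => i1 i2; case: (mxtens_indexP j) => j1 j2.
rewrite tensmxE !ord1 mxE mulr1.
by congr (A _ _); apply: val_inj; rewrite /= muln1 addn0.
Qed.

End Cast.
Arguments resize {K p} q A.

(** * Operators acting in consecutive tensor factors *)

Section ActOn.
Variables (K : pzRingType) (N : nat).
Implicit Types m n i j : nat.

Lemma act_onE m n i (X : 'M[K]_(N ^ m)) :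
  act_on n i X = resize (N ^ n)
    ((1%:M : 'M_(N ^ i.-1)) *t X *t (1%:M : 'M_(N ^ (n - (i.-1 + m))))).
Proof. by []. Qed.

Lemma act_on_size m n i : (i.-1 + m <= n)%N ->
  (N ^ i.-1 * N ^ m * N ^ (n - (i.-1 + m)) = N ^ n)%N.
Proof. by move=> h; rewrite -!expnD subnKC. Qed.

Lemma act_on_id n (X : 'M[K]_(N ^ n)) : act_on n 1 X = X.
Proof.
rewrite act_onE /= add0n subnn tensmx1 resize_resize ?muln1// tens1mx.
by rewrite resize_resize ?mul1n// resize_id.
Qed.

Lemma act_on1 m n i : (i.-1 + m <= n)%N ->
  act_on n i (1%:M : 'M[K]_(N ^ m)) = 1%:M.
Proof. by move=> h; rewrite act_onE !tensmx11 resize1 ?act_on_size. Qed.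

Lemma act_onM m n i (X Y : 'M[K]_(N ^ m)) : (i.-1 + m <= n)%N ->
  act_on n i (X *m Y) = act_on n i X *m act_on n i Y.
Proof.
move=> h; rewrite !act_onE -resizeM ?act_on_size//; congr (resize _ _).
rewrite tensmx_mul_comm => [|*]; last by apply/commr_sym/comm_mx1.
by rewrite tensmx_mul_comm => [|*]; [rewrite !mul1mx | apply: comm_mx1].
Qed.

Lemma act_onD m n i (X Y : 'M[K]_(N ^ m)) : (i.-1 + m <= n)%N ->
  act_on n i (X + Y) = act_on n i X + act_on n i Y.
Proof.
move=> h; rewrite !act_onE -resizeD ?act_on_size//; congr (resize _ _).
apply/matrixP => k l; case: (mxtens_indexP k) => k' k3.
case: (mxtens_indexP l) => l' l3.
case: (mxtens_indexP k') => k1 k2; case: (mxtens_indexP l') => l1 l2.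
by rewrite [RHS]mxE !tensmxE [(X + Y) _ _]mxE mulrDr mulrDl.
Qed.

(** Placing X in a group of factors that is itself placed among n factors. *)
Lemma act_on_nested l m n i j (X : 'M[K]_(N ^ l)) : (0 < j)%N ->
    (j.-1 + l <= m)%N -> (i.-1 + m <= n)%N ->
  act_on n i (act_on m j X) = act_on n (i.-1 + j) X.
Proof.
move=> j0 hm hn.
rewrite !act_onE resize_tensr ?act_on_size// resize_tensl ?act_on_size//.
rewrite resize_resize ?act_on_size// tensmx_nest.
rewrite -(expnD N i.-1) -(expnD N (m - _)).
have -> : (m - (j.-1 + l) + (n - (i.-1 + m)) = n - ((i.-1 + j).-1 + l))%N by lia.
by have -> : (i.-1 + j.-1 = (i.-1 + j).-1)%N by lia.
Qed.

Lemma act_onZ (c : K) m n i (X : 'M[K]_(N ^ m)) : (i.-1 + m <= n)%N ->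
  act_on n i (c *: X) = c *: act_on n i X.
Proof.
move=> h; apply/matrixP => k l; rewrite !act_onE mxE !(resizeE (act_on_size h)).
move: (cast_ord _ k) (cast_ord _ l) => {}k {}l.
case: (mxtens_indexP k) => k' k3; case: (mxtens_indexP l) => l' l3.
case: (mxtens_indexP k') => k1 k2; case: (mxtens_indexP l') => l1 l2.
rewrite !tensmxE [(c *: X) _ _]mxE !mulrA; congr (_ * _ * _).
exact/commr_sym/comm_mx1.
Qed.

End ActOn.

Lemma map_act_on (K K' : pzRingType) (f : {rmorphism K -> K'}) N m n i
    (X : 'M[K]_(N ^ m)) :
  map_mx f (act_on n i X) = act_on n i (map_mx f X).
Proof. by rewrite /act_on map_conform_mx !map_mxT !map_mx1 map_mx0. Qed.

(** Operators acting in disjoint groups of tensor factors commute, provided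
    that one of them has central entries. *)
Lemma act_on_comm (F K : pzRingType) (f : {rmorphism F -> K}) N l m n i j
    (X : 'M[K]_(N ^ m)) (Y : 'M[F]_(N ^ l)) :
    (forall a x, f a * x = x * f a) -> (0 < i)%N ->
    (i + m <= j)%N -> (j.-1 + l <= n)%N ->
  act_on n i X *m map_mx f (act_on n j Y) =
  map_mx f (act_on n j Y) *m act_on n i X.
Proof.
move=> fC i0 ij jn; rewrite !map_act_on.
have -> : act_on n i X = act_on n 1 (act_on j.-1 i X).
  by rewrite act_on_nested//; lia.
have -> : act_on n j (map_mx f Y) = act_on n j (map_mx f (act_on (n - j.-1) 1 Y)).
  rewrite map_act_on act_on_nested//=; try lia.
  by congr act_on; lia.
move: (act_on j.-1 i X) (act_on (n - j.-1) 1 Y) => {}X {}Y.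
have e : (N ^ j.-1 * N ^ (n - j.-1) = N ^ n)%N by rewrite -expnD subnKC//; lia.
have -> : act_on n 1 X = resize (N ^ n) (X *t (1%:M : 'M_(N ^ (n - j.-1)))).
  by rewrite act_onE tens1mx resize_tensl ?mul1n// resize_resize ?mul1n.
have -> : act_on n j (map_mx f Y) =
    resize (N ^ n) ((1%:M : 'M_(N ^ j.-1)) *t map_mx f Y).
  rewrite act_onE subnKC; last by lia.
  by rewrite subnn tensmx1 resize_resize ?muln1.
rewrite -!resizeM//; congr (resize _ _).
rewrite tensmx_mul_comm => [|*]; last exact: comm_mx1.
rewrite mulmx1 mul1mx tensmx_mul_comm => [|a b c d]; last by rewrite mxE; apply: fC.
by rewrite mulmx1 mul1mx.
Qed.

(** * The relations of the quantum double as matrix identities *)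

Lemma map_mx_crossing (A B : pzRingType) (f : {rmorphism A -> B}) n
    (X Y U V : 'M[A]_n) :
  map_mx f (Y *m V *m X - (V *m X *m U *m Y *m U + 1%:M)) = 0 ->
  map_mx f Y *m map_mx f V *m map_mx f X =
  map_mx f V *m map_mx f X *m map_mx f U *m map_mx f Y *m map_mx f U + 1%:M.
Proof. by rewrite map_mxB map_mxD map_mx1 !map_mxM => /subr0_eq. Qed.

Section QuantumDoubleRelations.
Variables (F : fieldType) (N : nat) (R : 'M[F]_(N ^ 2)).
Local Notation K := (qdouble R).
Local Notation M1 := (act_on 2 1 (Mmx R : 'M_(N ^ 1))).
Local Notation D1 := (act_on 2 1 (Dmx R : 'M_(N ^ 1))).
Local Notation r := (map_mx (qd_const R) R).
Local Notation rV := (map_mx (qd_const R) (invmx R)).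
Local Notation qpi := (@quot_pi _ _ (@qd_relation F N R)).

Lemma qd_constC (a : F) (x : K) : qd_const R a * x = x * qd_const R a.
Proof. by rewrite /= /quot_const -quot_scaleAl -quot_scaleAr mul1r mulr1. Qed.

Lemma map_in_alg (X : 'M[F]_(N ^ 2)) :
  map_mx qpi (map_mx (in_alg (freealg F (qd_gen N))) X) = map_mx (qd_const R) X.
Proof. by apply/matrixP => i j; rewrite !mxE linearZ /= rmorph1. Qed.

Lemma qd_relation0 (X : 'M[freealg F (qd_gen N)]_(N ^ 2)) :
  (forall i j, qd_relation R (X i j)) -> map_mx qpi X = 0.
Proof.
move=> hX; apply/matrixP => i j; rewrite !mxE -(rmorph0 qpi).
by apply/quot_piP; rewrite subr0; apply: ideal_gen_in.
Qed.

Lemma qd_MM : r *m M1 *m r *m M1 = M1 *m r *m M1 *m r.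
Proof.
apply/eqP; rewrite -subr_eq0; apply/eqP.
rewrite -map_in_alg /Mmx -!(map_act_on qpi) -!map_mxM -map_mxB.
by apply: qd_relation0 => i j; exists i, j; apply: Or31.
Qed.

Lemma qd_DD : rV *m D1 *m rV *m D1 = D1 *m rV *m D1 *m rV.
Proof.
apply/eqP; rewrite -subr_eq0; apply/eqP.
rewrite -map_in_alg /Dmx -!(map_act_on qpi) -!map_mxM -map_mxB.
by apply: qd_relation0 => i j; exists i, j; apply: Or32.
Qed.

Lemma qd_DM : D1 *m r *m M1 = r *m M1 *m rV *m D1 *m rV + 1%:M.
Proof.
pose fM := act_on 2 1 (free_M F N : 'M_(N ^ 1)).
pose fD := act_on 2 1 (free_D F N : 'M_(N ^ 1)).
pose fr := map_mx (in_alg (freealg F (qd_gen N))) R.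
pose fV := map_mx (in_alg (freealg F (qd_gen N))) (invmx R).
have h : map_mx qpi (fD *m fr *m fM - (fr *m fM *m fV *m fD *m fV + 1%:M)) = 0.
  by apply: qd_relation0 => i j; exists i, j; apply: Or33.
have <- : map_mx qpi fM = M1 by rewrite (map_act_on qpi).
have <- : map_mx qpi fD = D1 by rewrite (map_act_on qpi).
have <- : map_mx qpi fr = r by rewrite map_in_alg.
have <- : map_mx qpi fV = rV by rewrite map_in_alg.
exact (map_mx_crossing h).
Qed.

End QuantumDoubleRelations.

Lemma scalar_mx_central (K : pzRingType) n (c : K) (X : 'M[K]_n) :
  (forall x, c * x = x * c) -> c%:M *m X = X *m c%:M.
Proof.
move=> cC; rewrite mul_scalar_mx -diag_const_mx mul_mx_diag.
by apply/matrixP => i j; rewrite !mxE cC.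
Qed.

Section TransportRelations.
Variables (K : pzRingType) (N n : nat).
Hypothesis n1 : (1 < n)%N.
Implicit Types X Y U V : 'M[K]_(N ^ 2).
Local Notation act Z := (act_on n 1 Z : 'M[K]_(N ^ n)).

Lemma act_on_reflection X Y : Y *m X *m Y *m X = X *m Y *m X *m Y ->
  act Y * act X * act Y * act X = act X * act Y * act X * act Y.
Proof. by move=> /(congr1 (act_on n 1)); rewrite !act_onM. Qed.

Lemma act_on_crossing X Y U V :
  Y *m V *m X = V *m X *m U *m Y *m U + 1%:M ->
  act Y * act V * act X = act V * act X * act U * act Y * act U + 1.
Proof.
by move=> /(congr1 (act_on n 1)); rewrite act_onD// act_on1// !act_onM.
Qed.

End TransportRelations.

(** * The operators R_i *)

Section BraidOperators.
Variables (F : fieldType) (N : nat) (R : 'M[F]_(N ^ 2)) (n : nat).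

Lemma Rop_braid i : braiding R -> (0 < i)%N -> (i.+1 < n)%N ->
  Rop R n i *m Rop R n i.+1 *m Rop R n i =
  Rop R n i.+1 *m Rop R n i *m Rop R n i.+1.
Proof.
move=> + i0 hi; rewrite /braiding /Rop.
have -> : act_on n i R = act_on n i (act_on 3 1 R).
  by rewrite act_on_nested ?addn1 ?prednK//; lia.
have -> : act_on n i.+1 R = act_on n i (act_on 3 2 R).
  by rewrite act_on_nested ?addn2 ?prednK//; lia.
by move=> b; rewrite -!act_onM ?b//; lia.
Qed.

Lemma Rop_far i j : (0 < i)%N -> (i.+1 < j)%N -> (j < n)%N ->
  Rop R n i *m Rop R n j = Rop R n j *m Rop R n i.
Proof.
move=> i0 ij jn; have := @act_on_comm F F idfun N 2 2 n i j R R.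
by rewrite map_mx_id//; apply => //; [move=> a x; apply: mulrC | lia | lia].
Qed.

End BraidOperators.

Section HeckeOperators.
Variables (F : fieldType) (N : nat) (q : F) (R : 'M[F]_(N ^ 2)).
Hypothesis q0 : q != 0.
Hypothesis heckeR : hecke_symmetry q R.

Lemma hecke_sqr : R *m R = 1%:M + (q - q^-1) *: R.
Proof.
have [_] := heckeR; rewrite mulmxDr !mulmxBl -scalar_mxM mulfV// !mul_scalar_mx.
rewrite mul_mx_scalar => /eqP; rewrite addrA subr_eq0 => /eqP <-.
by rewrite scalerBl addrAC -addrA.
Qed.

Lemma hecke_unit : R \in unitmx.
Proof.
have : R *m (R - (q - q^-1)%:M) = 1%:M.
  by rewrite mulmxBr hecke_sqr mul_mx_scalar addrK.
by case/mulmx1_unit.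
Qed.

Variable n : nat.

Lemma Rop_hecke i : (0 < i < n)%N ->
  Rop R n i *m Rop R n i = 1%:M + (q - q^-1) *: Rop R n i.
Proof.
by move=> hi; rewrite /Rop -act_onM ?hecke_sqr ?act_onD ?act_on1 ?act_onZ//; lia.
Qed.

Lemma Rop_inv i : (0 < i < n)%N ->
  invmx (Rop R n i) = act_on n i (invmx R).
Proof.
move=> hi; have e : Rop R n i *m act_on n i (invmx R) = 1%:M.
  by rewrite /Rop -act_onM ?mulmxV ?hecke_unit ?act_on1//; lia.
have [u _] := mulmx1_unit e.
by rewrite -[RHS]mul1mx -(mulVmx u) -mulmxA e mulmx1.
Qed.

Lemma Rop_unit i : (0 < i < n)%N -> Rop R n i \in unitmx.
Proof.
move=> hi; have e : Rop R n i *m act_on n i (invmx R) = 1%:M.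
  by rewrite /Rop -act_onM ?mulmxV ?hecke_unit ?act_on1//; lia.
by have [] := mulmx1_unit e.
Qed.

End HeckeOperators.

(** * The symmetrizer identity in the quantum double *)

Section SymmetrizerCapelli.
Variables (F : fieldType) (N : nat) (q : F) (R : 'M[F]_(N ^ 2)).
Hypothesis q0 : q != 0.
Hypothesis qint_neq0 : forall k : nat, (1 <= k)%N -> qint q k != 0.
Hypothesis heckeR : hecke_symmetry q R.
Variable n : nat.
Hypothesis n0 : (0 < n)%N.
Local Notation E := 'M[qdouble R]_(N ^ n).

(** Scalar operators on V^(x)n. *)
Definition qd_scalar : {rmorphism F -> E} :=
  (map_mx (qd_const R) : {rmorphism _ -> _}) \o (@scalar_mx F (N ^ n)).

Lemma qd_scalarE a : qd_scalar a = map_mx (qd_const R) a%:M.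
Proof. by []. Qed.

Lemma qd_scalarC a (X : E) : qd_scalar a * X = X * qd_scalar a.
Proof.
rewrite qd_scalarE map_scalar_mx.
exact (scalar_mx_central X (qd_constC a)).
Qed.

Let r i : E := map_mx (qd_const R) (Rop R n i).
Let r' i : E := map_mx (qd_const R) (invmx (Rop R n i)).
Local Notation m := (act_on n 1 (Mmx R : 'M_(N ^ 1)) : E).
Local Notation d := (act_on n 1 (Dmx R : 'M_(N ^ 1)) : E).

Lemma copyE (X : 'M[qdouble R]_N) j :
  copy (qd_const R) R n X j = braid_copy r r' (act_on n 1 (X : 'M_(N ^ 1))) j.
Proof.
elim: j => [|[|j] IHj]; first by rewrite braid_copy0.
  by rewrite braid_copy1.
rewrite (@braid_copyS _ _ _ _ j.+1 isT) -IHj.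
reflexivity.
Qed.

Lemma act_on_first2 (X : 'M[qdouble R]_(N ^ 1)) : (1 < n)%N ->
  act_on n 1 (act_on 2 1 X) = act_on n 1 X.
Proof. by move=> n1; rewrite act_on_nested. Qed.

Lemma r1E : (1 < n)%N -> r 1 = act_on n 1 (map_mx (qd_const R) R).
Proof. by move=> n1; rewrite /r /Rop map_act_on. Qed.

Lemma r'1E : (1 < n)%N -> r' 1 = act_on n 1 (map_mx (qd_const R) (invmx R)).
Proof. by move=> n1; rewrite /r' (Rop_inv q0 heckeR)// map_act_on. Qed.

Lemma symmetrizer_hsym k : (k <= n)%N ->
  map_mx (qd_const R) (act_on n 1 (symmetrizer q R k)) = hsym r qd_scalar q k.
Proof.
elim: k => [|[|k] IHk] kn.
- by rewrite act_on1// map_mx1.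
- by rewrite act_on1// map_mx1.
rewrite hsymS// -IHk; last by lia.
have -> : symmetrizer q R k.+2 = (qint q k.+2)^-1 *:
   (act_on k.+2 1 (symmetrizer q R k.+1) *m
    ((q ^- k.+1)%:M + qint q k.+1 *: Rop R k.+2 k.+1) *m
    act_on k.+2 1 (symmetrizer q R k.+1)) by [].
move: (symmetrizer q R k.+1) => S.
have nS : act_on n 1 (act_on k.+2 1 S) = act_on n 1 S by rewrite act_on_nested.
have nR : act_on n 1 (Rop R k.+2 k.+1) = Rop R n k.+1.
  by rewrite /Rop act_on_nested//=; lia.
rewrite act_onZ// !act_onM// act_onD// act_onZ// nS nR -scalemx1 act_onZ//.
rewrite act_on1// scalemx1 -!mul_scalar_mx /r.
move: (act_on n 1 S) (Rop R n k.+1) => A B.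
rewrite !(map_mxM (qd_const R)) (map_mxD (qd_const R)) (map_mxM (qd_const R)).
reflexivity.
Qed.

Lemma comm_r_act1 (X : 'M[qdouble R]_(N ^ 1)) i : (1 < i < n)%N ->
  GRing.comm (r i) (act_on n 1 X).
Proof.
move=> hi; apply/commr_sym.
have h1 : (1 + 1 <= i)%N by lia.
have h2 : (i.-1 + 2 <= n)%N by lia.
exact: (@act_on_comm F (qdouble R) (qd_const R) N 2 1 n 1 i X R
  (@qd_constC F N R) isT h1 h2).
Qed.

Lemma act_qd_MM : (1 < n)%N -> r 1 * m * r 1 * m = m * r 1 * m * r 1.
Proof.
move=> n1; rewrite (r1E n1) -(act_on_first2 (Mmx R) n1).
exact (@act_on_reflection (qdouble R) N n n1 _ _ (qd_MM R)).
Qed.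

Lemma act_qd_DD : (1 < n)%N -> r' 1 * d * r' 1 * d = d * r' 1 * d * r' 1.
Proof.
move=> n1; rewrite (r'1E n1) -(act_on_first2 (Dmx R) n1).
exact (@act_on_reflection (qdouble R) N n n1 _ _ (qd_DD R)).
Qed.

Lemma act_qd_DM : (1 < n)%N -> d * r 1 * m = r 1 * m * r' 1 * d * r' 1 + 1.
Proof.
move=> n1; rewrite (r1E n1) (r'1E n1).
rewrite -(act_on_first2 (Mmx R) n1) -(act_on_first2 (Dmx R) n1).
exact (@act_on_crossing (qdouble R) N n n1 _ _ _ _ (qd_DM R)).
Qed.

Theorem symmetrizer_capelli :
  let num := map_mx (qd_const R) in
  let cp := copy (qd_const R) R n in
  let c := fun a : F => num a%:M : E in
  let S := num (symmetrizer q R n) in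
  S * (\prod_(1 <= j < n.+1) (cp (Mmx R *m Dmx R) j - c (q ^- j.-1 * qint q j.-1))) * S
    = c (q ^- (n * n.-1)) * S *
      ((\prod_(1 <= j < n.+1) cp (Mmx R) j)
            * (\prod_(j <- rev (index_iota 1 n.+1)) cp (Dmx R) j)).
Proof.
move=> num cp c S.
have -> : S = hsym r qd_scalar q n.
  by rewrite /S -(symmetrizer_hsym (leqnn n)) act_on_id.
have -> : \prod_(1 <= j < n.+1)
      (cp (Mmx R *m Dmx R) j - c (q ^- j.-1 * qint q j.-1)) =
    \prod_(1 <= j < n.+1)
      (braid_copy r r' (m * d) j - qd_scalar (q ^- j.-1 * qint q j.-1)).
  apply: eq_bigr => j _; rewrite /cp copyE.
  by rewrite (@act_onM (qdouble R) N 1 n 1 (Mmx R) (Dmx R) n0).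
have -> : \prod_(1 <= j < n.+1) cp (Mmx R) j = mprod r r' m n.
  by apply: eq_bigr => j _; rewrite /cp copyE.
have -> : \prod_(j <- rev (index_iota 1 n.+1)) cp (Dmx R) j = dprod r r' d n.
  by apply: eq_bigr => j _; rewrite /cp copyE.
apply: (capelli_hsym (n := n)).
- by move=> i hi; rewrite /r /r' -[LHS]map_mxM mulmxV ?map_mx1// (Rop_unit q0 heckeR).
- by move=> i hi; rewrite /r /r' -[LHS]map_mxM mulVmx ?map_mx1// (Rop_unit q0 heckeR).
- move=> i i0 hi; rewrite /r; move: (Rop_braid (proj1 heckeR) i0 hi).
  move: (Rop R n i) (Rop R n i.+1) => A B /(congr1 (map_mx (qd_const R))).
  by rewrite !(map_mxM (qd_const R)).
- move=> i j i0 ij jn; rewrite /GRing.comm /r; move: (Rop_far R i0 ij jn).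
  move: (Rop R n i) (Rop R n j) => A B /(congr1 (map_mx (qd_const R))).
  by rewrite !(map_mxM (qd_const R)).
- exact: comm_r_act1.
- exact: comm_r_act1.
- exact: act_qd_MM.
- exact: act_qd_DD.
- exact: act_qd_DM.
- exact: qd_scalarC.
- exact: q0.
- exact: qint_neq0.
- move=> i hi; rewrite /r; move: (Rop_hecke q0 heckeR hi).
  move: (Rop R n i) => A /(congr1 (map_mx (qd_const R))).
  rewrite -mul_scalar_mx (map_mxD (qd_const R)) !(map_mxM (qd_const R)).
  by rewrite (map_mx1 (qd_const R)).
- by rewrite n0 leqnn.
Qed.

End SymmetrizerCapelli.

(** * Replacing q by -1/q *)

Section Inversion.
Variables (F : fieldType) (N : nat) (q : F) (R : 'M[F]_(N ^ 2)).
Local Notation p := (- q^-1).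

Lemma qint_oppV k : qint p k = - (-1) ^+ k * qint q k.
Proof.
have pk : p ^+ k = (-1) ^+ k * q ^- k by rewrite [LHS]exprNn exprVn.
have pV : p^-1 = - q by rewrite invrN invrK.
have pVk : p ^- k = (-1) ^+ k * q ^+ k by rewrite -exprVn pV [LHS]exprNn.
rewrite /qint pVk pk pV opprK (addrC (- q^-1)) -mulrBr -(opprB (q ^+ k)).
by rewrite mulrN !mulNr mulrA.
Qed.

Lemma hecke_symmetry_oppV : hecke_symmetry q R -> hecke_symmetry p R.
Proof.
case=> bR hR; split=> //.
rewrite invrN invrK.
have -> : (- q^-1)%:M - R = - ((q^-1)%:M + R) by rewrite rmorphN opprD.
have -> : (- q)%:M + R = - (q%:M - R) by rewrite rmorphN opprB addrC.
rewrite mulNmx mulmxN opprK -hR mulmxBr mulmxBl !mulmxDl !mulmxDr.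
by congr (_ + _ - (_ + _)); rewrite scalar_mxC.
Qed.

Lemma skewsymmetrizerE k : skewsymmetrizer q R k = symmetrizer p R k.
Proof.
elim: k => [//|[//|k] IHk].
transitivity ((qint q k.+2)^-1 *: (act_on k.+2 1 (skewsymmetrizer q R k.+1) *m
    ((q ^+ k.+1)%:M - qint q k.+1 *: Rop R k.+2 k.+1) *m
    act_on k.+2 1 (skewsymmetrizer q R k.+1))); first by [].
transitivity ((qint p k.+2)^-1 *: (act_on k.+2 1 (symmetrizer p R k.+1) *m
    ((p ^- k.+1)%:M + qint p k.+1 *: Rop R k.+2 k.+1) *m
    act_on k.+2 1 (symmetrizer p R k.+1))); last by [].
rewrite IHk; move: (act_on _ _ _) (Rop _ _ _) => A B.
have -> : (p ^- k.+1)%:M + qint p k.+1 *: B =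
    (-1) ^+ k.+1 *: ((q ^+ k.+1)%:M - qint q k.+1 *: B).
  rewrite -exprVn invrN invrK (exprNn q) scalerBr scale_scalar_mx scalerA.
  by rewrite qint_oppV mulNr scaleNr.
rewrite -scalemxAr -scalemxAl scalerA; congr (_ *: _).
have -> : qint p k.+2 = (-1) ^+ k.+1 * qint q k.+2.
  by rewrite qint_oppV [in LHS](exprS _ k.+1) mulN1r opprK.
have s0 : (-1) ^+ k.+1 != 0 :> F by rewrite signr_eq0.
move: (qint q k.+2) ((-1) ^+ k.+1) s0 => x s s0.
by rewrite invfM mulrAC mulVf ?mul1r.
Qed.

End Inversion.

Theorem skewsymmetrizer_capelli (F : fieldType) (N : nat) (q : F)
    (R : 'M[F]_(N ^ 2)) (n : nat) :
  q != 0 -> (forall k : nat, (1 <= k)%N -> qint q k != 0) ->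
  hecke_symmetry q R -> (0 < n)%N ->
  let num := map_mx (qd_const R) in
  let cp := copy (qd_const R) R n in
  let c := fun a : F => num a%:M : 'M[qdouble R]_(N ^ n) in
  let A := num (skewsymmetrizer q R n) in
  A * (\prod_(1 <= j < n.+1) (cp (Mmx R *m Dmx R) j + c (q ^+ j.-1 * qint q j.-1))) * A
    = c (q ^+ (n * n.-1)) * A *
      ((\prod_(1 <= j < n.+1) cp (Mmx R) j)
            * (\prod_(j <- rev (index_iota 1 n.+1)) cp (Dmx R) j)).
Proof.
move=> q0 qint_neq0 heckeR n0 num cp c A.
have p0 : - q^-1 != 0 by rewrite oppr_eq0 invr_eq0.
have pint k : (1 <= k)%N -> qint (- q^-1) k != 0.
  by move=> k1; rewrite qint_oppV mulf_neq0 ?oppr_eq0 ?signr_eq0 ?qint_neq0.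
have pV j : (- q^-1) ^- j = (-1) ^+ j * q ^+ j.
  by rewrite -exprVn invrN invrK [LHS]exprNn.
have cj j : c ((- q^-1) ^- j * qint (- q^-1) j) = - c (q ^+ j * qint q j).
  have -> : (- q^-1) ^- j * qint (- q^-1) j = - (q ^+ j * qint q j).
    rewrite pV qint_oppV mulNr mulrN; congr (- _).
    by rewrite mulrACA -expr2 sqrr_sign mul1r.
  by rewrite /c /num rmorphN map_mxN.
have cn : c (q ^+ (n * n.-1)) = c ((- q^-1) ^- (n * n.-1)).
  (* n (n-1) is even. *)
  have e : (-1) ^+ (n * n.-1) = 1 :> F.
    by rewrite -signr_odd oddM -[in odd n](prednK n0) /= andNb.
  by rewrite pV e mul1r.
have eL : \prod_(1 <= j < n.+1)
      (cp (Mmx R *m Dmx R) j + c (q ^+ j.-1 * qint q j.-1)) =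
    \prod_(1 <= j < n.+1)
      (cp (Mmx R *m Dmx R) j - c ((- q^-1) ^- j.-1 * qint (- q^-1) j.-1)).
  by apply: eq_bigr => j _; rewrite cj opprK.
have hA : A = num (symmetrizer (- q^-1) R n).
  exact (congr1 num (skewsymmetrizerE q R n)).
rewrite eL cn hA.
exact (symmetrizer_capelli p0 pint (hecke_symmetry_oppV heckeR) n0).
Qed.

Unset Implicit Arguments.

Theorem theorem3 (RR : realType) (N : nat) (q : RR[i]) (R : 'M[RR[i]]_(N ^ 2)) :
  (1 <= N)%N ->
  q != 0 -> q != 1 -> q != -1 ->
  (forall k : nat, (1 <= k)%N -> qint q k != 0) ->
  hecke_symmetry q R ->
  skew_invertible R ->
  forall k : nat, (1 <= k)%N ->
  let M := Mmx R in
  let D := Dmx R in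
  let L := M *m D in
  let cp := copy (qd_const R) R k in
  let num := map_mx (qd_const R) in
  let c := fun a : RR[i] => num a%:M : 'M[qdouble R]_(N ^ k) in
  let A := num (skewsymmetrizer q R k) in
  let S := num (symmetrizer q R k) in
  let MD := (\prod_(1 <= j < k.+1) cp M j)
            * (\prod_(j <- rev (index_iota 1 k.+1)) cp D j) in
  A * (\prod_(1 <= j < k.+1) (cp L j + c (q ^+ j.-1 * qint q j.-1))) * A
    = c (q ^+ (k * k.-1)) * A * MD
  /\
  S * (\prod_(1 <= j < k.+1) (cp L j - c (q ^- j.-1 * qint q j.-1))) * S
    = c (q ^- (k * k.-1)) * S * MD.
Proof.
move=> _ q0 _ _ qint_neq0 heckeR _ k k0; split.
- exact (skewsymmetrizer_capelli q0 qint_neq0 heckeR k0).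
- exact (symmetrizer_capelli q0 qint_neq0 heckeR k0).
Qed.
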